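(* Consider a commutative diagram in $\mathcal{C}$ $$\begin{array}{ccccc} K & \xrightarrow{k} & A & \xrightarrow{f} & B \\ {\scriptstyle u}\downarrow & & {\scriptstyle a}\downarrow & & {\scriptstyle b}\downarrow \\ K' & \xrightarrow{k'} & A' & \xrightarrow{f'} & B' \end{array}$$ in which the rows are short $\mathcal{Z}$-exact sequences. If $u$ and $b$ are isomorphisms, then $a$ is an isomorphism, too.
   Context: $\mathcal{C}$ is a regular protomodular category equipped with a full subcategory $\mathcal{Z}$ such that: $\mathcal{Z}$ is posetal (there is at most one morphism between any two objects of $\mathcal{Z}$); $\mathcal{Z}$ is monocoreflective, i.e. the inclusion $\mathcal{Z} \hookrightarrow \mathcal{C}$ has a right adjoint (the coreflector) $\mathsf{Z} \colon \mathcal{C} \to \mathcal{Z}$ whose counit components $\varepsilon_A \colon \mathsf{Z}(A) \to A$ are monomorphisms; and $\mathsf{Z}$ inverts monomorphisms, i.e. if $m$ is a monomorphism in $\mathcal{C}$ then $\mathsf{Z}(m)$ is an isomorphism. Without loss of generality $\mathsf{Z}$ is the identity on $\mathcal{Z}$. $\mathcal{N}_{\mathcal{Z}}$ denotes the class of morphisms of $\mathcal{C}$ that factor through an object of $\mathcal{Z}$. A $\mathcal{Z}$-kernel of $f \colon A \to B$ is a morphism $k \colon K \to A$ such that $fk \in \mathcal{N}_{\mathcal{Z}}$ and, whenever $e \colon E \to A$ satisfies $fe \in \mathcal{N}_{\mathcal{Z}}$, there is a unique $\varphi \colon E \to K$ with $k\varphi = e$. A sequence $A \xrightarrow{k} B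 \xrightarrow{f} C$ is short $\mathcal{Z}$-exact if $f$ is a regular epimorphism and $k$ is the $\mathcal{Z}$-kernel of $f$. *)

(* Defs.v *)
From Corelib Require Import ssreflect ssrbool.
From Stdlib Require Import ProofIrrelevance.

Set Implicit Arguments.
Unset Strict Implicit.
Unset Printing Implicit Defensive.

Declare Scope cat_scope.
Open Scope cat_scope.

Record category := Category {
  Ob :> Type;
  Hom : Ob -> Ob -> Type;
  idm : forall X, Hom X X;
  comp : forall X Y Z, Hom Y Z -> Hom X Y -> Hom X Z;
  comp_idl : forall X Y (f : Hom X Y), comp (idm Y) f = f;
  comp_idr : forall X Y (f : Hom X Y), comp f (idm X) = f;
  comp_assoc : forall X Y Z T (h : Hom Z T) (g : Hom Y Z) (f : Hom X Y),
    comp h (comp g f) = comp (comp h g) f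
}.

Arguments Hom {c} X Y.
Arguments idm {c} X.
Arguments comp {c X Y Z} g f : rename.
Notation "g ∘ f" := (comp g f) (at level 40, left associativity) : cat_scope.

Record functor (C D : category) := Functor {
  fobj :> C -> D;
  fmap : forall X Y : C, Hom X Y -> Hom (fobj X) (fobj Y);
  fmap_id : forall X : C, fmap (idm X) = idm (fobj X);
  fmap_comp : forall (X Y Z : C) (g : Hom Y Z) (f : Hom X Y),
    fmap (g ∘ f) = fmap g ∘ fmap f
}.

Arguments fmap {C D} F {X Y} f : rename.

(** [adjunction F G] is the data of an adjunction [F] -| [G]. *)
Record adjunction (C D : category) (F : functor C D) (G : functor D C) :=
  Adjunction {
  unit : forall X : C, Hom X (G (F X));
  counit : forall Y : D, Hom (F (G Y)) Y;
  unit_nat : forall (X X' : C) (f : Hom X X'),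
    unit X' ∘ f = fmap G (fmap F f) ∘ unit X;
  counit_nat : forall (Y Y' : D) (g : Hom Y Y'),
    counit Y' ∘ fmap F (fmap G g) = g ∘ counit Y;
  triangle_left : forall X : C, counit (F X) ∘ fmap F (unit X) = idm (F X);
  triangle_right : forall Y : D, fmap G (counit Y) ∘ unit (G Y) = idm (G Y)
}.

Arguments unit {C D F G} adj X : rename.
Arguments counit {C D F G} adj Y : rename.

Definition iso (C : category) (X Y : C) (f : Hom X Y) : Prop :=
  exists g : Hom Y X, g ∘ f = idm X /\ f ∘ g = idm Y.

Definition mono (C : category) (X Y : C) (m : Hom X Y) : Prop :=
  forall (T : C) (x y : Hom T X), m ∘ x = m ∘ y -> x = y.

Definition is_coequalizer (C : category) (X Y Q : C) (x y : Hom X Y)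
    (q : Hom Y Q) : Prop :=
  q ∘ x = q ∘ y /\
  forall (T : C) (t : Hom Y T), t ∘ x = t ∘ y ->
    exists! s : Hom Q T, s ∘ q = t.

Definition regular_epi (C : category) (Y Q : C) (q : Hom Y Q) : Prop :=
  exists (X : C) (x y : Hom X Y), is_coequalizer x y q.

Definition conservative (C D : category) (F : functor C D) : Prop :=
  forall (X Y : C) (f : Hom X Y), iso (fmap F f) -> iso f.

Definition has_terminal (C : category) : Prop :=
  exists I : C, forall X : C, exists! _ : Hom X I, True.

(** The universal property carries the mediating morphisms as data, so that
    chosen pullbacks yield pullback functors without any choice principle. *)
Record pullback (C : category) (X Y S : C) (f : Hom X S) (g : Hom Y S) :=
  Pullback {
  pb_obj :> C;
  pb_fst : Hom pb_obj X;
  pb_snd : Hom pb_obj Y;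
  pb_sq : f ∘ pb_fst = g ∘ pb_snd;
  pb_lift : forall (T : C) (x : Hom T X) (y : Hom T Y),
    f ∘ x = g ∘ y -> Hom T pb_obj;
  pb_lift_fst : forall (T : C) (x : Hom T X) (y : Hom T Y)
    (e : f ∘ x = g ∘ y), pb_fst ∘ pb_lift e = x;
  pb_lift_snd : forall (T : C) (x : Hom T X) (y : Hom T Y)
    (e : f ∘ x = g ∘ y), pb_snd ∘ pb_lift e = y;
  pb_uniq : forall (T : C) (s t : Hom T pb_obj),
    pb_fst ∘ s = pb_fst ∘ t -> pb_snd ∘ s = pb_snd ∘ t -> s = t
}.

Arguments pb_lift {C X Y S f g} P {T x y} e : rename.

Definition chosen_pullbacks (C : category) :=
  forall (X Y S : C) (f : Hom X S) (g : Hom Y S), pullback f g.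

Definition has_pullbacks (C : category) : Prop :=
  forall (X Y S : C) (f : Hom X S) (g : Hom Y S), inhabited (pullback f g).

Definition finitely_complete (C : category) : Prop :=
  has_terminal C /\ has_pullbacks C.

Definition regular (C : category) : Prop :=
  [/\ finitely_complete C,
      forall (X Y : C) (f : Hom X Y) (P : pullback f f),
        exists (Q : C) (q : Hom X Q), is_coequalizer (pb_fst P) (pb_snd P) q
    & forall (X Y S : C) (f : Hom X S) (g : Hom Y S) (P : pullback f g),
        regular_epi g -> regular_epi (pb_fst P)].

Record point (C : category) (B : C) := Point {
  pt_obj : C;
  pt_map : Hom pt_obj B;
  pt_sec : Hom B pt_obj;
  pt_split : pt_map ∘ pt_sec = idm B
}.

Record point_hom (C : category) (B : C) (P Q : point B) := PointHom {
  ph_mor :> Hom (pt_obj P) (pt_obj Q);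
  ph_map : pt_map Q ∘ ph_mor = pt_map P;
  ph_sec : ph_mor ∘ pt_sec P = pt_sec Q
}.

Lemma point_hom_eq (C : category) (B : C) (P Q : point B)
  (f g : point_hom P Q) : ph_mor f = ph_mor g -> f = g.
Proof.
case: f g => [f f1 f2] [g g1 g2] /= e; move: f1 f2 g1 g2; rewrite e.
by move=> f1 f2 g1 g2; rewrite (proof_irrelevance _ f1 g1)
  (proof_irrelevance _ f2 g2).
Qed.

Section Points.
Variables (C : category) (B : C).

Definition pt_id (P : point B) : point_hom P P.
Proof. exists (idm (pt_obj P)); [exact: comp_idr | exact: comp_idl]. Defined.

Definition pt_comp (P Q R : point B) (g : point_hom Q R) (f : point_hom P Q) :
  point_hom P R.
Proof.
exists (ph_mor g ∘ ph_mor f).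
- by rewrite comp_assoc !ph_map.
- by rewrite -comp_assoc !ph_sec.
Defined.

(** The category Pt_B(C) of split epimorphisms over [B] with a chosen
    splitting. *)
Definition Pt : category.
Proof.
refine (@Category (point B) (@point_hom C B) pt_id pt_comp _ _ _).
- by move=> P Q f; apply: point_hom_eq; exact: comp_idl.
- by move=> P Q f; apply: point_hom_eq; exact: comp_idr.
- by move=> P Q R S h g f; apply: point_hom_eq; exact: comp_assoc.
Defined.

End Points.

Section ChangeOfBase.
Variables (C : category) (pb : chosen_pullbacks C) (E B : C) (h : Hom E B).

Lemma cob_sec_eq (P : point B) : h ∘ idm E = pt_map P ∘ (pt_sec P ∘ h).
Proof. by rewrite comp_assoc pt_split comp_idl comp_idr. Qed.

Definition cob_obj (P : point B) : point E :=
  @Point C E (pb h (pt_map P)) (pb_fst (pb h (pt_map P)))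
    (pb_lift (pb h (pt_map P)) (cob_sec_eq P)) (pb_lift_fst _ _).

Lemma cob_mor_eq (P Q : point B) (f : point_hom P Q) :
  h ∘ pb_fst (pb h (pt_map P)) = pt_map Q ∘ (f ∘ pb_snd (pb h (pt_map P))).
Proof. by rewrite comp_assoc ph_map pb_sq. Qed.

Definition cob_mor (P Q : point B) (f : point_hom P Q) :
  point_hom (cob_obj P) (cob_obj Q).
Proof.
exists (pb_lift (pb h (pt_map Q)) (cob_mor_eq f)).
- exact: pb_lift_fst.
- apply: pb_uniq => /=; rewrite comp_assoc ?pb_lift_fst ?pb_lift_snd //.
  by rewrite -comp_assoc pb_lift_snd comp_assoc ph_sec.
Defined.

(** The change-of-base functor [h^* : Pt_B(C) -> Pt_E(C)]. *)
Definition change_of_base : functor (Pt B) (Pt E).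
Proof.
refine (@Functor (Pt B) (Pt E) cob_obj cob_mor _ _).
- move=> P; apply: point_hom_eq; apply: pb_uniq => /=.
  + by rewrite pb_lift_fst comp_idr.
  + by rewrite pb_lift_snd comp_idr comp_idl.
- move=> P Q R g f; apply: point_hom_eq; apply: pb_uniq => /=.
  + by rewrite comp_assoc !pb_lift_fst.
  + by rewrite comp_assoc !pb_lift_snd -!comp_assoc pb_lift_snd.
Defined.

End ChangeOfBase.

(** Conservativity of change of base does not depend on the choice of
    pullbacks; quantifying over all choices keeps the definition choice-free. *)
Definition protomodular (C : category) : Prop :=
  has_pullbacks C /\
  forall (pb : chosen_pullbacks C) (E B : C) (h : Hom E B),
    conservative (change_of_base pb h).

Definition full_subcategory (C : category) (Z : C -> Prop) : category :=
  @Category {X : C | Z X} (fun X Y => Hom (proj1_sig X) (proj1_sig Y))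
    (fun X => idm (proj1_sig X))
    (fun X Y T g f => g ∘ f)
    (fun X Y f => comp_idl f)
    (fun X Y f => comp_idr f)
    (fun X Y T U h g f => comp_assoc h g f).

Definition inclusion (C : category) (Z : C -> Prop) :
    functor (full_subcategory Z) C :=
  @Functor (full_subcategory Z) C (fun X => proj1_sig X) (fun X Y f => f)
    (fun X => eq_refl) (fun X Y T g f => eq_refl).

Arguments inclusion {C} Z.

Definition posetal (C : category) : Prop :=
  forall (X Y : C) (f g : Hom X Y), f = g.

Definition Znull (C : category) (Z : C -> Prop) (X Y : C) (f : Hom X Y) : Prop :=
  exists (T : C) (g : Hom X T) (h : Hom T Y), Z T /\ f = h ∘ g.

Definition is_Zkernel (C : category) (Z : C -> Prop) (K A B : C)
    (f : Hom A B) (k : Hom K A) : Prop :=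
  Znull Z (f ∘ k) /\
  forall (E : C) (e : Hom E A), Znull Z (f ∘ e) ->
    exists! phi : Hom E K, k ∘ phi = e.

Definition short_Zexact (C : category) (Z : C -> Prop) (K A B : C)
    (k : Hom K A) (f : Hom A B) : Prop :=
  regular_epi f /\ is_Zkernel Z f k.

(* Main.v *)
(** Replacing [f'] by [b^-1 f'] we may assume that [a] is a morphism over [B].
    The kernel pair [A ×_B A] and the pullback [A' ×_B A] are points over [A],
    split by the diagonal and by [(a, 1)], and [a × 1] is a morphism between
    them. Pulled back along [k] it becomes an isomorphism: an element of [A] or
    [A'] lying over the image of [f k] factors through the Z-kernel, where [u]
    is invertible. So [a × 1] is an isomorphism by protomodularity, whence [a]
    is a monomorphism through which the regular epimorphism [A' ×_B A -> A']
    factors. *)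
From Corelib Require Import ssreflect ssrbool.
From Stdlib Require Import ClassicalEpsilon.
Require Import Defs.

Set Implicit Arguments.
Unset Strict Implicit.
Unset Printing Implicit Defensive.

Section Generalities.
Variable C : category.

(** Conservativity of change of base is stated for chosen pullbacks, so mere existence must first be
    turned into a choice. *)
Lemma choose_pullbacks : has_pullbacks C -> inhabited (chosen_pullbacks C).
Proof.
move=> hp; constructor=> X Y S f g.
have ex : exists _ : pullback f g, True by case: (hp _ _ _ f g) => P; exists P.
exact: (proj1_sig (constructive_indefinite_description _ ex)).
Qed.

Lemma mono_split_epi_iso (X Y : C) (m : Hom X Y) (s : Hom Y X) :
  mono m -> m ∘ s = idm Y -> iso m.
Proof.
move=> mm ms; exists s; split=> //.
by apply: mm; rewrite comp_assoc ms comp_idl comp_idr.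
Qed.

Lemma iso_mono (X Y : C) (m : Hom X Y) : iso m -> mono m.
Proof.
by move=> [n [nm _]] T x y e; rewrite -(comp_idl x) -(comp_idl y) -nm
  -!comp_assoc e.
Qed.

Lemma regular_epi_cancel (Y Q T : C) (q : Hom Y Q) (s t : Hom Q T) :
  regular_epi q -> s ∘ q = t ∘ q -> s = t.
Proof.
move=> [X [x [y [e univ]]]] est.
have [|r [_ uniq]] := univ T (t ∘ q); first by rewrite -!comp_assoc e.
by rewrite -(uniq s est) (uniq t).
Qed.

(** As [m] is monic, [q] coequalizes the pair defining [m ∘ q], hence factors through [m ∘ q]; the
    factor is a section of [m]. *)
Lemma regular_epi_factor_mono_iso (Y X Q : C) (q : Hom Y X) (m : Hom X Q) :
  mono m -> regular_epi (m ∘ q) -> iso m.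
Proof.
move=> mm re; case: (re) => [R [x [y [e univ]]]].
have [|s [sq _]] := univ _ q; first by apply: mm; rewrite !comp_assoc.
apply: (mono_split_epi_iso mm (s := s)); apply: (regular_epi_cancel re).
by rewrite -comp_assoc sq comp_idl.
Qed.

Lemma Pt_iso (B : C) (P Q : Pt B) (m : Hom P Q) : iso (ph_mor m) -> iso m.
Proof.
move=> [n [nm mn]].
have n_map : pt_map P ∘ n = pt_map Q.
  by rewrite -(ph_map m) -comp_assoc mn comp_idr.
have n_sec : n ∘ pt_sec Q = pt_sec P.
  by rewrite -(ph_sec m) comp_assoc nm comp_idl.
by exists (PointHom n_map n_sec); split; apply: point_hom_eq.
Qed.

Lemma iso_of_Pt_iso (B : C) (P Q : Pt B) (m : Hom P Q) :
  iso m -> iso (ph_mor m).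
Proof.
move=> [n [nm mn]]; exists (ph_mor n); split.
- by rewrite -[LHS]/(ph_mor (n ∘ m)) nm.
- by rewrite -[LHS]/(ph_mor (m ∘ n)) mn.
Qed.

End Generalities.

Section FibrewiseIso.
Variables (C : category) (C_regular : regular C) (C_protomodular : protomodular C).
Variables (A A' B E : C) (f : Hom A B) (f' : Hom A' B) (a : Hom A A').
Variable h : Hom E A.
Hypothesis over : f' ∘ a = f.
Hypothesis f_regular : regular_epi f.
(** With [fibre_surj]: [a] is bijective on generalized elements lying over [f ∘ h], the form in
    which Z-kernels will supply it. *)
Hypothesis fibre_inj : forall (T : C) (e : Hom T E) (y z : Hom T A),
  f ∘ y = f ∘ (h ∘ e) -> f ∘ z = f ∘ (h ∘ e) -> a ∘ y = a ∘ z -> y = z.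
Hypothesis fibre_surj : forall (T : C) (e : Hom T E) (y : Hom T A'),
  f' ∘ y = f ∘ (h ∘ e) -> exists x : Hom T A, a ∘ x = y.

Lemma iso_of_iso_on_fibres : iso a.
Proof.
case: (C_protomodular) => /choose_pullbacks [pb] cons.
pose R := pb _ _ _ f f; pose S := pb _ _ _ f' f.
have dR : f ∘ idm A = f ∘ idm A by [].
have dS : f' ∘ a = f ∘ idm A by rewrite over comp_idr.
pose P : Pt A := Point (pb_lift_snd R dR).
pose Q : Pt A := Point (pb_lift_snd S dS).
have eM : f' ∘ (a ∘ pb_fst R) = f ∘ pb_snd R.
  by rewrite comp_assoc over pb_sq.
pose M := pb_lift S eM.
have M1 : pb_fst S ∘ M = a ∘ pb_fst R := pb_lift_fst S eM.
have M2 : pb_snd S ∘ M = pb_snd R := pb_lift_snd S eM.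
have M_sec : M ∘ pt_sec P = pt_sec Q.
  apply: (pb_uniq (p := S)) => /=; rewrite comp_assoc ?M1 ?M2 ?pb_lift_snd //.
  by rewrite -comp_assoc !pb_lift_fst comp_idr.
pose m : Hom P Q := PointHom (P := P) (Q := Q) M2 M_sec.
have iM : iso M. {
  apply: (iso_of_Pt_iso (m := m)); apply: (cons pb _ _ h); apply: Pt_iso.
  set N := ph_mor _.
  (* An element of [U] amounts to a pair [(e, y)] with [y] in [A] and [f y = f (h e)]; for [V], [y]
     is in [A'] and [f' y = f (h e)]. In these terms [N] sends [(e, y)] to [(e, a y)]. *)
  pose U := pb _ _ _ h (pt_map P); pose V := pb _ _ _ h (pt_map Q).
  have N1 : pb_fst V ∘ N = pb_fst U by exact: pb_lift_fst.
  have N2 : pb_snd V ∘ N = M ∘ pb_snd U by exact: pb_lift_snd.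
  have U_sq : pb_snd R ∘ pb_snd U = h ∘ pb_fst U by rewrite (pb_sq U).
  have V_sq : pb_snd S ∘ pb_snd V = h ∘ pb_fst V by rewrite (pb_sq V).
  have N_mono : mono N. {
    move=> T x y e.
    have e1 : pb_fst U ∘ x = pb_fst U ∘ y by rewrite -N1 -!comp_assoc e.
    have e2 : M ∘ (pb_snd U ∘ x) = M ∘ (pb_snd U ∘ y).
      by rewrite !comp_assoc -N2 -!comp_assoc e.
    have base (z : Hom T U) :
        f ∘ (pb_fst R ∘ (pb_snd U ∘ z)) = f ∘ (h ∘ (pb_fst U ∘ z)).
      by rewrite comp_assoc pb_sq -comp_assoc !(comp_assoc _ _ z) U_sq.
    apply: (pb_uniq (p := U)) => //; apply: (pb_uniq (p := R)).
    + apply: (fibre_inj (e := pb_fst U ∘ x)); rewrite ?base ?e1 //.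
      by rewrite !(comp_assoc a) -M1 -!(comp_assoc _ M) e2.
    + by rewrite !comp_assoc U_sq -!comp_assoc e1.
  }
  (* Lifting the universal element of [V] along [a] yields a section of [N]; being monic, [N] is
     then invertible. *)
  have [|y ay] := fibre_surj (e := pb_fst V) (y := pb_fst S ∘ pb_snd V).
    by rewrite comp_assoc pb_sq -comp_assoc V_sq.
  have e1 : f ∘ y = f ∘ (h ∘ pb_fst V).
    by rewrite -V_sq comp_assoc -pb_sq -comp_assoc -ay comp_assoc over.
  have e2 : h ∘ pb_fst V = pt_map P ∘ pb_lift R e1 by rewrite /= pb_lift_snd.
  apply: (mono_split_epi_iso N_mono (s := pb_lift U e2)).
  apply: (pb_uniq (p := V)); rewrite comp_idr comp_assoc.
  - by rewrite N1 pb_lift_fst.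
  - rewrite N2 -comp_assoc pb_lift_snd.
    apply: (pb_uniq (p := S)); rewrite comp_assoc.
    + by rewrite M1 -comp_assoc pb_lift_fst.
    + by rewrite M2 pb_lift_snd.
}
have a_mono : mono a. {
  move=> T x y e.
  (* [M] sends [(x, y)] to [(a x, y)] and [(y, y)] to [(a y, y)], which agree. *)
  have exy : f ∘ x = f ∘ y by rewrite -over -!comp_assoc e.
  have exx : f ∘ y = f ∘ y by [].
  rewrite -(pb_lift_fst R exy) -[RHS](pb_lift_fst R exx); congr (_ ∘ _).
  apply: (iso_mono iM); apply: (pb_uniq (p := S)); rewrite !comp_assoc.
  - by rewrite M1 -!comp_assoc !pb_lift_fst.
  - by rewrite M2 !pb_lift_snd.
}
(* Here [a ∘ pb_fst R ∘ n] equals [pb_fst S], which is a pullback of the regular epimorphism [f]. *)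
case: iM => n [_ Mn].
apply: (regular_epi_factor_mono_iso (q := pb_fst R ∘ n) a_mono).
rewrite comp_assoc -M1 -comp_assoc Mn comp_idr.
by case: C_regular => _ _; apply.
Qed.

End FibrewiseIso.

Section ZKernels.
Variables (C : category) (Z : C -> Prop).

Lemma Znull_compr (X Y T : C) (g : Hom X Y) (x : Hom T X) :
  Znull Z g -> Znull Z (g ∘ x).
Proof.
move=> [O [p [q [ZO ->]]]].
by exists O, (p ∘ x), q; split=> //; rewrite comp_assoc.
Qed.

Lemma Znull_compl (X Y T : C) (g : Hom X Y) (y : Hom Y T) :
  Znull Z g -> Znull Z (y ∘ g).
Proof.
move=> [O [p [q [ZO ->]]]].
by exists O, p, (y ∘ q); split=> //; rewrite comp_assoc.
Qed.

Lemma Zkernel_mono (K A B : C) (f : Hom A B) (k : Hom K A) :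
  is_Zkernel Z f k -> mono k.
Proof.
move=> [fk univ] T x y e.
have [|r [_ uniq]] := univ T (k ∘ y).
  by rewrite comp_assoc; exact: Znull_compr.
by rewrite -(uniq x e) (uniq y).
Qed.

(** Null morphisms form an ideal and [b'] cancels [b], so [f ∘ e] is null exactly when [b ∘ f ∘ e]
    is. *)
Lemma Zkernel_comp_mono (K A B B' : C) (f : Hom A B) (k : Hom K A)
    (b : Hom B B') (b' : Hom B' B) :
  b' ∘ b = idm B -> is_Zkernel Z f k -> is_Zkernel Z (b ∘ f) k.
Proof.
move=> b'b [fk univ]; split=> [|E e be].
  by rewrite -comp_assoc; exact: Znull_compl.
apply: univ; rewrite -(comp_idl f) -b'b -!comp_assoc; apply: Znull_compl.
by rewrite comp_assoc.
Qed.

End ZKernels.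

Theorem proposition5p2
  (C : category) (C_regular : regular C) (C_protomodular : protomodular C)
  (Z : C -> Prop) (Z_posetal : posetal (full_subcategory Z))
  (coref : functor C (full_subcategory Z))
  (adj : adjunction (inclusion Z) coref)
  (counit_mono : forall A : C, mono (counit adj A))
  (coref_inverts_mono : forall (X Y : C) (m : Hom X Y),
    mono m -> iso (fmap coref m))
  (K A B K' A' B' : C)
  (k : Hom K A) (f : Hom A B) (k' : Hom K' A') (f' : Hom A' B')
  (u : Hom K K') (a : Hom A A') (b : Hom B B')
  (left_square : comp a k = comp k' u)
  (right_square : comp b f = comp f' a)
  (top_exact : short_Zexact Z k f)
  (bottom_exact : short_Zexact Z k' f')
  (u_iso : iso u) (b_iso : iso b) :
  iso a.
Proof.
case: top_exact => f_regular k_ker; case: bottom_exact => _ k'_ker.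
case: b_iso => b' [b'b bb'].
have {}k'_ker : is_Zkernel Z (b' ∘ f') k' := Zkernel_comp_mono bb' k'_ker.
have over : b' ∘ f' ∘ a = f.
  by rewrite -comp_assoc -right_square comp_assoc b'b comp_idl.
(* Take [h := k]: an element with the same image in [B] as some [k ∘ e] has null image, hence
   factors through the Z-kernel. *)
have null (T : C) (e : Hom T K) : Znull Z (f ∘ (k ∘ e)).
  by rewrite comp_assoc; apply: Znull_compr; case: k_ker.
apply: (iso_of_iso_on_fibres C_regular C_protomodular (h := k) over) => //.
- move=> T e y z ye ze ayz.
  have [|p [py _]] := proj2 k_ker T y; first by rewrite ye.
  have [|q [qz _]] := proj2 k_ker T z; first by rewrite ze.
  rewrite -py -qz; congr (_ ∘ _).
  (* The factors [p] and [q] agree after [k' ∘ u = a ∘ k], a composite of monomorphisms. *)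
  apply: (iso_mono u_iso); apply: (Zkernel_mono k'_ker).
  by rewrite !comp_assoc -left_square -!comp_assoc py qz.
- move=> T e y ye; case: u_iso => u' [_ uu'].
  have [|p [py _]] := proj2 k'_ker T y; first by rewrite ye.
  (* The factor [p] of [y] through [k'] is carried back along the inverse of [u]. *)
  exists (k ∘ (u' ∘ p)).
  by rewrite comp_assoc left_square -comp_assoc (comp_assoc u) uu' comp_idl.
Qed.
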